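(* Let $1\le d\le n$. The inner normal fan $\Sigma_{d,n}$ of the Catalan pellytope $\mathcal P_{d,n}$ has $n+\sum_{j=n-d+1}^{n}j$ rays, generated by $$\pm e_i\ \text{ for } i\in[n]\qquad\text{and}\qquad e_i-e_{i+k}\ \text{ for } i\in[n-k],\ k\in[d-1].$$
   Context: $[m]=\{1,\dots,m\}$. Let $f_1,\dots,f_n$ be the standard basis of $\mathbb R^n$ and $e_1,\dots,e_n$ the dual basis of $(\mathbb R^n)^*$. For $1\le k\le n$, $1\le j\le n-k+1$ let $q_{k,j}=1+y_j+y_jy_{j+1}+\cdots+y_jy_{j+1}\cdots y_{j+k-1}$, where $y_i$ has exponent vector $f_i$. The Catalan pellytope is $\mathcal P_{d,n}=\operatorname{Newt}\bigl(\prod_{k=1}^{d}\prod_{j=1}^{n-k+1}q_{k,j}\bigr)\subset\mathbb R^n$. Its inner normal fan $\Sigma_{d,n}\subset(\mathbb R^n)^*$ has as maximal cones the sets $\{w:\langle v,w\rangle\le\langle v',w\rangle\ \forall v'\in\mathcal P_{d,n}\}$ for $v$ a vertex of $\mathcal P_{d,n}$. *)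

(* Defs.v *)
From mathcomp Require Import all_boot all_order all_algebra.
From mathcomp Require Import boolp classical_sets functions cardinality reals.
From mathcomp Require Import mpoly.

Set Implicit Arguments.
Unset Strict Implicit.
Unset Printing Implicit Defensive.

Import Order.TTheory GRing.Theory Num.Theory.

Local Open Scope classical_set_scope.
Local Open Scope ring_scope.

(* R^n is the space of row vectors and its dual is the space of column vectors;
   the dual basis vector e_i is [delta_mx i 0 : 'cV[R]_n]. *)
Definition pairing (R : realType) (n : nat) (v : 'rV[R]_n) (w : 'cV[R]_n) : R :=
  (v *m w) 0 0.

Definition conv_hull (R : realType) (V : lmodType R) (A : set V) : set V :=
  [set x | exists (m : nat) (a : 'I_m -> R) (v : 'I_m -> V),
     [/\ forall i, 0 <= a i, \sum_i a i = 1, forall i, A (v i)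
       & x = \sum_i a i *: v i]].

Definition exponent_vector (R : realType) (n : nat) (m : 'X_{1..n}) : 'rV[R]_n :=
  \row_(i < n) (m i)%:R.

Definition Newt (R : realType) (n : nat) (p : {mpoly R[n]}) : set 'rV[R]_n :=
  conv_hull [set exponent_vector R m | m in [set m | m \in msupp p]].

(* The labels j and k are 1-based, so y_j is the variable 'X_i with i + 1 = j.
   The l-th summand is y_j y_(j+1) ... y_(j+l-1). *)
Definition pell_factor (R : realType) (n k j : nat) : {mpoly R[n]} :=
  \sum_(0 <= l < k.+1) \prod_(i < n | (j <= i.+1 < j + l)%N) 'X_i.

Definition catalan_pellytope (R : realType) (d n : nat) : set 'rV[R]_n :=
  Newt (\prod_(1 <= k < d.+1) \prod_(1 <= j < (n - k + 1).+1)
          pell_factor R n k j).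
Arguments catalan_pellytope : clear implicits.

Section NormalFan.
Variables (R : realType) (n : nat).
Implicit Types (P : set 'rV[R]_n) (C F : set 'cV[R]_n).

(* A vertex is a face of P consisting of a single point. *)
Definition vertex P (v : 'rV[R]_n) : Prop :=
  exists w : 'cV[R]_n,
    [set x | P x /\ forall y, P y -> pairing x w <= pairing y w] = [set v].

Definition normal_cone P (v : 'rV[R]_n) : set 'cV[R]_n :=
  [set w | forall v', P v' -> pairing v w <= pairing v' w].

Definition cone_face C F : Prop :=
  exists u : 'rV[R]_n,
    (forall w, C w -> 0 <= pairing u w) /\ F = [set w | C w /\ pairing u w = 0].

(* The fan consists of its maximal cones together with all their faces. *)
Definition inner_normal_fan P : set (set 'cV[R]_n) :=
  [set F | exists v, vertex P v /\ cone_face (normal_cone P v) F].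

(* The dimension of a cone is that of its linear span, the smallest subspace
   containing it. *)
Definition cone_has_dim C (k : nat) : Prop :=
  exists U : {vspace 'cV[R]_n},
    [/\ forall w, C w -> w \in U,
        forall U' : {vspace 'cV[R]_n},
          (forall w, C w -> w \in U') -> (U <= U')%VS
      & \dim U = k].

Definition fan_rays (Sigma : set (set 'cV[R]_n)) : set (set 'cV[R]_n) :=
  [set C | Sigma C /\ cone_has_dim C 1].

Definition ray_generated_by (g : 'cV[R]_n) : set 'cV[R]_n :=
  [set t *: g | t in [set t : R | 0 <= t]].

(* With 0-based ordinals, i in [n-k] amounts to i + k being an index below n. *)
Definition pell_generators (d : nat) : set 'cV[R]_n :=
  [set g | (exists i : 'I_n, g = delta_mx i 0 \/ g = - delta_mx i 0) \/
           (exists (i j : 'I_n) (k : nat),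
              [/\ (1 <= k <= d - 1)%N, j = (i + k)%N :> nat
                & g = delta_mx i 0 - delta_mx j 0])].

End NormalFan.

Arguments pell_generators : clear implicits.

(* Main.v *)
Require Import Defs.
From mathcomp Require Import all_boot all_order all_algebra.
From mathcomp Require Import boolp classical_sets functions cardinality reals.
From mathcomp Require Import mpoly finmap.
From mathcomp Require Import zify lra.

Set Implicit Arguments.
Unset Strict Implicit.
Unset Printing Implicit Defensive.

Import Order.TTheory GRing.Theory Num.Theory.

Local Open Scope classical_set_scope.
Local Open Scope ring_scope.

(** Write S_j = w_1 + ... + w_j for the prefix sums of a functional w. The
    exponent vector of the l-th term of q_{k,j} pairs with w to
    S_{j-1+l} - S_{j-1}, so minimising w over Newt(q_{k,j}) means minimising S
    over the window of positions [j-1, j-1+k]. Since the coefficients are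
    nonnegative, the pellytope is the Minkowski sum of these simplices, and its
    lattice points [lattice_point f] come from choosing one position in every
    window. Hence w lies in the normal cone at [lattice_point f] exactly when f
    chooses a minimiser of S in each window ([lattice_point_normal],
    [normal_selects]).

    The claimed ray generators are the functionals whose S is, up to a constant,
    the indicator of an interval of positions, a plateau [lo, hi]: e_i is
    [i, n], - e_i is [0, i-1], and e_i - e_{i+k} is [i, i+k-1]. An interior
    plateau of length at most d - 1 fits, together with both its neighbours, in
    a window of d + 1 positions, and this is why exactly these intervals occur.

    Every ray is a plateau. Any w != 0 splits as c g + w' with c > 0 and g a
    plateau so that in each window some position minimises both summands
    ([exists_plateau], [common_minimisers]). Then g lies in every normal cone
    that contains w, and in every face of it that contains w. A face spanning a
    line is therefore generated by a plateau, because normal cones are pointed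
    ([ray_is_plateau]).

    Every plateau is a ray. A small perturbation of g has pairwise distinct
    prefix sums, so it picks a vertex whose normal cone contains g
    ([vertex_on_plateau]). The face of that cone on which all minimisers of g
    remain minimisers is the ray of g, because taking equal values on them in
    all windows determines a functional up to scaling ([plateau_rigid],
    [plateau_is_ray]).

    The count enumerates the plateaus; distinct plateaus are not positively
    proportional, since the signs of their entries differ. *)

(** * Pairings and convex hulls *)

Section Pairing.
Variables (R : realType) (n : nat).
Implicit Types (v x y : 'rV[R]_n) (w : 'cV[R]_n).

Lemma pairingE v w : pairing v w = \sum_i v 0 i * w i 0.
Proof. by rewrite /pairing mxE. Qed.

Lemma pairingDl x y w : pairing (x + y) w = pairing x w + pairing y w.
Proof. by rewrite /pairing mulmxDl mxE. Qed.

Lemma pairingDr v (w w' : 'cV[R]_n) :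
  pairing v (w + w') = pairing v w + pairing v w'.
Proof. by rewrite /pairing mulmxDr mxE. Qed.

Lemma pairingZl a v w : pairing (a *: v) w = a * pairing v w.
Proof. by rewrite /pairing -scalemxAl mxE. Qed.

Lemma pairingZr a v w : pairing v (a *: w) = a * pairing v w.
Proof. by rewrite /pairing -scalemxAr mxE. Qed.

Lemma pairing_suml (I : Type) (r : seq I) (Q : pred I) (F : I -> 'rV[R]_n) w :
  pairing (\sum_(i <- r | Q i) F i) w = \sum_(i <- r | Q i) pairing (F i) w.
Proof. by rewrite /pairing mulmx_suml summxE. Qed.

Lemma pairingBl x y w : pairing (x - y) w = pairing x w - pairing y w.
Proof. by rewrite pairingDl -scaleN1r pairingZl mulN1r. Qed.

Lemma sub_conv_hull (A : set 'rV[R]_n) : A `<=` conv_hull A.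
Proof.
move=> x Ax; exists 1%N, (fun=> 1), (fun=> x).
by split=> //; rewrite big_ord1 // scale1r.
Qed.

Lemma conv_hull_ge (A : set 'rV[R]_n) w c :
  (forall x, A x -> c <= pairing x w) ->
  forall x, conv_hull A x -> c <= pairing x w.
Proof.
move=> cA _ [m [a [v [a0 a1 Av ->]]]].
rewrite pairing_suml -[c]mul1r -a1 mulr_suml; apply: ler_sum => i _.
by rewrite pairingZl ler_wpM2l // cA.
Qed.

(** In a convex combination attaining the minimum, every point of positive
    weight attains it too. *)
Lemma conv_hull_min_uniq (A : set 'rV[R]_n) w v :
  (forall x, A x -> pairing v w <= pairing x w) ->
  (forall x, A x -> pairing x w <= pairing v w -> x = v) ->
  forall x, conv_hull A x -> pairing x w <= pairing v w -> x = v.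
Proof.
move=> vA uA _ [m [a [p [a0 a1 Ap ->]]]] le.
have z : \sum_i a i * (pairing (p i) w - pairing v w) = 0.
  apply/eqP; rewrite eq_le sumr_ge0 ?andbT => [|i _]; last first.
    by rewrite mulr_ge0 // subr_ge0 vA.
  under eq_bigr do rewrite mulrBr.
  rewrite sumrB -mulr_suml a1 mul1r subr_le0.
  by move: le; rewrite pairing_suml; under eq_bigr do rewrite pairingZl.
have zi i : a i * (pairing (p i) w - pairing v w) = 0.
  by apply: (psumr_eq0P _ z) => // j _; rewrite mulr_ge0 // subr_ge0 vA.
rewrite -[RHS]scale1r -a1 scaler_suml; apply: eq_bigr => i _.
have /eqP := zi i; rewrite mulf_eq0 => /orP[/eqP->|]; first by rewrite !scale0r.
by rewrite subr_eq0 => /eqP e; rewrite (uA (p i)) // e.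
Qed.

Lemma vertex_mem (P : set 'rV[R]_n) v : vertex P v -> P v.
Proof.
move=> [w e]; have : [set v] v by [].
by rewrite -e => -[].
Qed.

End Pairing.

(** * Supports of products with nonnegative coefficients *)

Section Support.
Variables (R : realType) (n : nat).
Implicit Types p q : {mpoly R[n]}.

Definition nonneg_coef p := forall m, 0 <= p@_m.

Lemma nonneg_coefM p q : nonneg_coef p -> nonneg_coef q -> nonneg_coef (p * q).
Proof.
by move=> p0 q0 m; rewrite mcoeffM sumr_ge0 // => k _; rewrite mulr_ge0.
Qed.

(** Without signs, no cancellation can remove a product of monomials. *)
Lemma msuppM_nonneg p q m1 m2 : nonneg_coef p -> nonneg_coef q ->
  m1 \in msupp p -> m2 \in msupp q -> (m1 + m2)%MM \in msupp (p * q).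
Proof.
move=> p0 q0; rewrite !mcoeff_msupp => n1 n2; rewrite mcoeffM.
have h1 : (mdeg m1 < (mdeg (m1 + m2)%MM).+1)%N by rewrite mdegD ltnS leq_addr.
have h2 : (mdeg m2 < (mdeg (m1 + m2)%MM).+1)%N by rewrite mdegD ltnS leq_addl.
rewrite (bigD1 (BMultinom h1, BMultinom h2)) //=.
rewrite gt_eqF // ltr_pwDl //; first by rewrite lt0r mulf_neq0 // mulr_ge0.
by apply: sumr_ge0 => k _; rewrite mulr_ge0.
Qed.

(** The Newton polytope of a product is the Minkowski sum of the Newton
    polytopes of the factors; this is the version for supports. *)
Lemma msupp_prod_nonneg (T : eqType) (r : seq T) (p : T -> {mpoly R[n]}) m :
  uniq r -> (forall i, nonneg_coef (p i)) ->
  m \in msupp (\prod_(i <- r) p i) <->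
  exists2 h : T -> 'X_{1..n}, (forall i, i \in r -> h i \in msupp (p i))
    & m = (\sum_(i <- r) h i)%MM.
Proof.
move=> ur p0.
suff [_] : nonneg_coef (\prod_(i <- r) p i) /\
  (m \in msupp (\prod_(i <- r) p i) <->
   exists2 h : T -> 'X_{1..n}, (forall i, i \in r -> h i \in msupp (p i))
    & m = (\sum_(i <- r) h i)%MM) by [].
elim: r ur m => [_|i r IH /= /andP[ir ur]] m.
  rewrite !big_nil msupp1 inE; split.
    by move=> k; rewrite mcoeff1 ler0n.
  split=> [/eqP->|[h _]]; last by rewrite big_nil => ->.
  by exists (fun=> 0%MM) => //; rewrite big_nil.
have pr0 := (IH ur 0%MM).1.
rewrite big_cons; split; first exact: nonneg_coefM.
split=> [/msuppM_le/allpairsP[[m1 m2] /= [s1 s2 ->]]|[h hr ->]]; last first.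
  rewrite big_cons; apply: msuppM_nonneg => //; first by rewrite hr ?mem_head.
  apply/(IH ur _).2; exists h => // j jr; apply: hr.
  by rewrite inE jr orbT.
have [h hr ->] := (IH ur m2).2.1 s2.
exists (fun j => if j == i then m1 else h j) => [j|].
  by rewrite inE; case: eqP => [->//|_ /= /hr].
rewrite big_cons eqxx; congr (_ + _)%MM.
rewrite !big_seq; apply: eq_bigr => j jr.
by case: eqP => // e; rewrite -e jr in ir.
Qed.

Lemma exponent_vectorD (m m' : 'X_{1..n}) :
  exponent_vector R (m + m')%MM = exponent_vector R m + exponent_vector R m'.
Proof. by apply/rowP => i; rewrite !mxE mnmDE natrD. Qed.

Lemma exponent_vector0 : exponent_vector R (0%MM : 'X_{1..n}) = 0.
Proof. by apply/rowP => i; rewrite !mxE mnm0E. Qed.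

Lemma exponent_vector_sum (T : Type) (r : seq T) (h : T -> 'X_{1..n}) :
  exponent_vector R (\sum_(i <- r) h i)%MM =
  \sum_(i <- r) exponent_vector R (h i).
Proof.
elim: r => [|i r IH]; first by rewrite !big_nil exponent_vector0.
by rewrite !big_cons exponent_vectorD IH.
Qed.

End Support.

(** * Windows and lattice points *)

Section CatalanPellytope.
Variables (R : realType) (d n : nat).
Hypotheses (hd : (1 <= d)%N) (hdn : (d <= n)%N).
Implicit Types (w g : 'cV[R]_n) (I : nat * nat) (f : nat * nat -> nat).

Definition psum w (j : nat) : R := \sum_(i < n | (i < j)%N) w i 0.

Definition prefix_step (s x : nat) : 'rV[R]_n := \row_i (s <= i < x)%N%:R.

(** The factor q_{k,j} is encoded by the pair (k, s) with s = j - 1, and stands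
    for the window [s, s + k] of positions of prefix sums. *)
Definition windows : seq (nat * nat) :=
  [seq (k, s) | k <- index_iota 1 d.+1, s <- index_iota 0 (n - k + 1)].

Definition window I : seq nat := iota I.2 I.1.+1.

(** A choice f picks in the window I the term ending at the absolute position
    f I of prefix sums, that is, the summand with index f I - I.2. *)
Definition admissible f := forall I, I \in windows -> f I \in window I.

Definition lattice_point f : 'rV[R]_n :=
  \sum_(I <- windows) prefix_step I.2 (f I).

Definition argmin w I (x : nat) : bool :=
  (x \in window I) && all (fun y => psum w x <= psum w y) (window I).

Definition selects w f := forall I, I \in windows -> argmin w I (f I).

Lemma mem_window I x : (x \in window I) = (I.2 <= x <= I.2 + I.1)%N.
Proof. by rewrite mem_iota addnS ltnS. Qed.

Lemma mem_windows I :
  (I \in windows) = [&& (0 < I.1)%N, (I.1 <= d)%N & (I.2 + I.1 <= n)%N].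
Proof.
apply/allpairsPdep/idP => [[k [s [+ + ->]]]|h] /=.
  by rewrite !mem_index_iota; lia.
by exists I.1, I.2; rewrite !mem_index_iota -surjective_pairing; split=> //; lia.
Qed.

Lemma windows_uniq : uniq windows.
Proof.
apply: allpairs_uniq_dep => [|k _|]; try exact: iota_uniq.
by move=> [k s] [k' s'] _ _ /= [-> ->].
Qed.

Lemma argminP w I x :
  reflect (x \in window I /\ forall y, y \in window I -> psum w x <= psum w y)
          (argmin w I x).
Proof. by apply: (iffP andP) => -[xI h]; split=> //; apply/allP. Qed.

Lemma selects_admissible w f : selects w f -> admissible f.
Proof. by move=> h I /h /argminP[]. Qed.

Lemma seq_argmin (S : nat -> R) (r : seq nat) :
  r != [::] -> exists2 x, x \in r & forall y, y \in r -> S x <= S y.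
Proof.
elim: r => // x [|z r] IH _.
  by exists x; rewrite ?mem_head // => y; rewrite inE => /eqP->.
have [//|y yr ymin] := IH; have [le|lt] := leP (S x) (S y).
  exists x; rewrite ?mem_head // => t; rewrite inE => /orP[/eqP->//|/ymin].
  exact: le_trans.
exists y; first by rewrite inE yr orbT.
by move=> t; rewrite inE => /orP[/eqP->|/ymin//]; apply: ltW.
Qed.

Lemma selects_exists w : exists f, selects w f.
Proof.
have E I : exists x, argmin w I x.
  have [//|x xI xmin] := @seq_argmin (psum w) (window I).
  by exists x; apply/argminP.
by have [f hf] := choice E; exists f => I _; apply: hf.
Qed.

(** * Prefix sums *)

Lemma psumD w w' j : psum (w + w') j = psum w j + psum w' j.
Proof. by rewrite /psum -big_split; apply: eq_bigr => i _; rewrite mxE. Qed.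

Lemma psumZ c w j : psum (c *: w) j = c * psum w j.
Proof. by rewrite /psum mulr_sumr; apply: eq_bigr => i _; rewrite mxE. Qed.

Lemma psum0 w : psum w 0 = 0.
Proof. by rewrite /psum big_pred0. Qed.

Lemma psum_split w x y : (x <= y)%N ->
  psum w y = psum w x + \sum_(i < n | (x <= i < y)%N) w i 0.
Proof.
move=> xy; rewrite /psum (bigID (fun i : 'I_n => (i < x)%N)) /=.
by congr (_ + _); apply: eq_bigl => i; lia.
Qed.

Lemma psumS w (i : 'I_n) : psum w i.+1 = psum w i + w i 0.
Proof.
rewrite (psum_split w (leqnSn i)); congr (_ + _).
rewrite (big_pred1 i) // => j.
by rewrite ltnS -eqn_leq eq_sym.
Qed.

Lemma psum_eq w x y : (x <= y)%N ->
  (forall i : 'I_n, (x <= i < y)%N -> w i 0 = 0) -> psum w x = psum w y.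
Proof. by move=> xy w0; rewrite (psum_split w xy) big1 ?addr0. Qed.

Lemma pairing_prefix_step s x w : (s <= x)%N ->
  pairing (prefix_step s x) w = psum w x - psum w s.
Proof.
move=> sx; rewrite (psum_split w sx) addrAC subrr add0r pairingE.
rewrite [RHS]big_mkcond; apply: eq_bigr => i _.
by rewrite mxE; case: (s <= i < x)%N; rewrite ?mul1r ?mul0r.
Qed.

Lemma pairing_lattice_point f w : admissible f ->
  pairing (lattice_point f) w =
  \sum_(I <- windows) (psum w (f I) - psum w I.2).
Proof.
move=> adm; rewrite pairing_suml !big_seq; apply: eq_bigr => I /adm.
by rewrite mem_window => /andP[h _]; apply: pairing_prefix_step.
Qed.

(** * The pellytope as a hull of lattice points *)

Definition step_monomial (j l : nat) : 'X_{1..n} :=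
  [multinom ((j <= i.+1 < j + l)%N : nat) | i < n].

Lemma pell_factorE k j :
  pell_factor R n k j = \sum_(0 <= l < k.+1) 'X_[step_monomial j l].
Proof.
apply: eq_bigr => l _; rewrite mpolyXE_id big_mkcond.
by apply: eq_bigr => i _; rewrite mnmE; case: (_ <= _ < _)%N.
Qed.

Lemma mcoeff_pell_factor k j m :
  (pell_factor R n k j)@_m =
  \sum_(0 <= l < k.+1) (step_monomial j l == m)%:R.
Proof.
rewrite pell_factorE raddf_sum; apply: eq_bigr => l _.
exact: mcoeffX.
Qed.

Lemma pell_factor_nonneg k j : nonneg_coef (pell_factor R n k j).
Proof. by move=> m; rewrite mcoeff_pell_factor sumr_ge0. Qed.

Lemma msupp_pell_factor k j m :
  m \in msupp (pell_factor R n k j) <->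
  exists2 l, (l <= k)%N & m = step_monomial j l.
Proof.
rewrite mcoeff_msupp mcoeff_pell_factor psumr_neq0 //; split.
  move=> /hasP[l]; rewrite mem_index_iota /= ltnS => lk.
  by rewrite ltr0n lt0b => /eqP <-; exists l.
move=> [l lk ->]; apply/hasP; exists l; first by rewrite mem_index_iota ltnS.
by rewrite eqxx ltr01.
Qed.

Lemma exponent_step_monomial s l :
  exponent_vector R (step_monomial s.+1 l) = prefix_step s (s + l).
Proof. by apply/rowP => i; rewrite !mxE mnmE ltnS addSn ltnS. Qed.

Lemma catalan_pellytopeE :
  catalan_pellytope R d n =
  conv_hull [set lattice_point f | f in [set f | admissible f]].
Proof.
rewrite /catalan_pellytope /Newt; congr conv_hull.
pose p I := pell_factor R n I.1 I.2.+1.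
have -> : \prod_(1 <= k < d.+1) \prod_(1 <= j < (n - k + 1).+1)
    pell_factor R n k j = \prod_(I <- windows) p I.
  rewrite big_allpairs_dep; apply: eq_bigr => k _.
  by rewrite big_add1.
have supp m := msupp_prod_nonneg m windows_uniq
  (fun I => pell_factor_nonneg I.1 I.2.+1).
apply/seteqP; split=> [_ [m /supp[h hs ->] <-]|_ [f adm <-]].
  have E I : exists x, I \in windows ->
      x \in window I /\ h I = step_monomial I.2.+1 (x - I.2)%N.
    have [Iw|] := boolP (I \in windows); last by exists 0%N.
    have /msupp_pell_factor[l lk hl] := hs I Iw.
    exists (I.2 + l)%N => _; rewrite addKn; split=> //.
    by rewrite mem_window leq_addr leq_add2l.
  have [f hf] := choice E; exists f; first by move=> I /hf[].
  rewrite exponent_vector_sum /lattice_point !big_seq.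
  apply: eq_bigr => I /hf[]; rewrite mem_window => /andP[le _] ->.
  by rewrite exponent_step_monomial subnKC.
exists (\sum_(I <- windows) step_monomial I.2.+1 (f I - I.2))%MM.
  apply/supp; exists (fun I => step_monomial I.2.+1 (f I - I.2)) => // I Iw.
  apply/msupp_pell_factor; exists (f I - I.2)%N => //.
  by move: (adm I Iw); rewrite mem_window leq_subLR => /andP[].
rewrite exponent_vector_sum /lattice_point !big_seq.
apply: eq_bigr => I /adm; rewrite mem_window => /andP[le _].
by rewrite exponent_step_monomial subnKC.
Qed.

(** * Normal cones of lattice points *)

Let P := catalan_pellytope R d n.

Lemma lattice_point_mem f : admissible f -> P (lattice_point f).
Proof. by move=> adm; rewrite /P catalan_pellytopeE; apply: sub_conv_hull; exists f. Qed.

Lemma lattice_point_min w f f' : selects w f -> admissible f' ->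
  pairing (lattice_point f) w <= pairing (lattice_point f') w.
Proof.
move=> sel adm; rewrite !pairing_lattice_point //; last exact: selects_admissible sel.
rewrite !big_seq; apply: ler_sum => I Iw; rewrite lerD2r.
by have /argminP[_] := sel I Iw; apply; apply: adm.
Qed.

Lemma lattice_point_normal w f :
  selects w f -> normal_cone P (lattice_point f) w.
Proof.
move=> sel; rewrite /P catalan_pellytopeE; apply: conv_hull_ge => _ [f' adm <-].
exact: lattice_point_min.
Qed.

(** Replacing the choice in one window only moves the lattice point within
    that summand. *)
Lemma normal_selects w f : admissible f ->
  normal_cone P (lattice_point f) w -> selects w f.
Proof.
move=> adm nw I Iw; apply/argminP; split; first exact: adm.
move=> y yI; pose f' J := if J == I then y else f J.
have adm' : admissible f'.
  by move=> J Jw; rewrite /f'; case: eqP => [->//|_]; apply: adm.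
have := nw _ (lattice_point_mem adm'); rewrite !pairing_lattice_point //.
rewrite !(bigD1_seq I Iw windows_uniq) /= {1}/f' eqxx.
rewrite [X in _ <= _ + X](eq_bigr (fun J => psum w (f J) - psum w J.2)).
  by rewrite lerD2r lerD2r.
by move=> J; rewrite /f' => /negbTE ->.
Qed.

Lemma unit_window (i : 'I_n) : (1%N, nat_of_ord i) \in windows.
Proof. by rewrite mem_windows /= hd addn1 ltn_ord. Qed.

(** Normal cones are pointed: the factors q_{1,j} already make the polytope
    full-dimensional. *)
Lemma normal_cone_pointed v w : P v ->
  normal_cone P v w -> normal_cone P v (- w) -> w = 0.
Proof.
move=> Pv nw nNw.
have [f sel] := selects_exists w; have adm := selects_admissible sel.
have e y : P y -> pairing v w = pairing y w.
  move=> Py; apply/eqP; rewrite eq_le nw //=.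
  by have := nNw y Py; rewrite -scaleN1r !pairingZr !mulN1r lerN2.
have selN : selects (- w) f.
  apply: normal_selects => // y Py.
  rewrite -scaleN1r !pairingZr -(e y Py) -(e (lattice_point f)) //.
  exact: lattice_point_mem.
apply/colP => i; rewrite mxE; apply: (addrI (psum w i)); rewrite -psumS addr0.
have /argminP[_ h1] := sel _ (unit_window i).
have /argminP[_ h2] := selN _ (unit_window i).
have c y : y \in window (1%N, nat_of_ord i) -> psum w y = psum w (f (1%N, nat_of_ord i)).
  move=> yI; apply/eqP; rewrite eq_le h1 // andbT.
  by have := h2 y yI; rewrite -scaleN1r !psumZ !mulN1r lerN2.
by rewrite !c // mem_window /=; lia.
Qed.

(** The lattice point of f attains the minimum of both summands, so the minimum
    of the sum is the sum of the minima, and v can only attain it by attaining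
    both. *)
Lemma normal_cone_split v w1 w2 f : P v -> selects w1 f -> selects w2 f ->
  normal_cone P v (w1 + w2) -> normal_cone P v w1 /\ normal_cone P v w2.
Proof.
move=> Pv s1 s2 nv.
have adm := selects_admissible s1.
have m1 := lattice_point_normal s1; have m2 := lattice_point_normal s2.
have := nv _ (lattice_point_mem adm); rewrite !pairingDr => le.
have := m1 v Pv; have := m2 v Pv => le2 le1.
by split=> y Py; [have := m1 y Py | have := m2 y Py]; lra.
Qed.

(** With pairwise distinct prefix sums there is a single minimiser in each
    window, so no other lattice point attains the minimum. *)
Lemma lattice_point_vertex w f :
  {in [pred x | (x <= n)%N] &, injective (psum w)} ->
  selects w f -> vertex P (lattice_point f).
Proof.
move=> inj sel; exists w; have adm := selects_admissible sel.
have mP := lattice_point_normal sel.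
apply/seteqP; split=> [x [Px xmin]|_ ->]; last first.
  by split; [exact: lattice_point_mem | exact: mP].
move: Px; rewrite /P catalan_pellytopeE => Px.
apply: (conv_hull_min_uniq (w := w)) Px _.
- by move=> _ [f' adm' <-]; apply: lattice_point_min.
- move=> _ [f' adm' <-]; rewrite !pairing_lattice_point // -subr_le0 -sumrB.
  move=> le; have ge I : I \in windows ->
      0 <= (psum w (f' I) - psum w I.2) - (psum w (f I) - psum w I.2).
    move=> Iw; have /argminP[_ /(_ _ (adm' I Iw))] := sel I Iw; lra.
  have /eqP : \sum_(I <- windows)
     ((psum w (f' I) - psum w I.2) - (psum w (f I) - psum w I.2)) = 0.
    by apply/eqP; rewrite eq_le le big_seq sumr_ge0.
  rewrite big_seq psumr_eq0 // => /allP z.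
  rewrite /lattice_point !big_seq; apply: eq_bigr => I Iw; congr prefix_step.
  have /implyP/(_ Iw)/eqP e := z I Iw.
  have := adm I Iw; have := adm' I Iw; rewrite !mem_window => h1 h2.
  move: Iw; rewrite mem_windows => Iw.
  by apply: inj; rewrite ?inE; [lia | lia | lra].
- exact/xmin/lattice_point_mem.
Qed.

(** * Plateaus *)

(** The functional e_lo - e_(hi+1) in 1-based notation, with e_0 = e_(n+1) = 0;
    its prefix sums are, up to a constant, the indicator of [lo, hi]. *)
Definition plateau (lo hi : nat) : 'cV[R]_n :=
  \col_i ((i.+1 == lo)%:R - (nat_of_ord i == hi)%:R).

(** The whole range [0, n] is left out because its functional is 0. An interior
    interval needs length hi - lo + 1 < d for some window to contain it together
    with both neighbours. *)
Definition is_plateau (p : nat * nat) : bool :=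
  [&& (p.1 <= p.2)%N, (p.2 <= n)%N, (0 < p.1)%N || (p.2 < n)%N
    & [|| p.1 == 0%N, p.2 == n | (p.2 - p.1 + 1 < d)%N]].

Lemma psum_plateau lo hi j : (lo <= hi)%N -> (j <= n)%N ->
  psum (plateau lo hi) j = (lo <= j <= hi)%N%:R - (lo == 0%N)%:R.
Proof.
move=> lohi; elim: j => [_|j IH jn].
  by rewrite psum0 leqn0 leq0n andbT subrr.
rewrite (psumS _ (Ordinal jn)) /= IH ?(ltnW jn) // mxE /=.
have [e1|n1] := eqVneq j.+1 lo; have [e2|n2] := eqVneq j hi; try lia.
- have -> : (lo <= j <= hi)%N = false by lia.
  have -> : (lo <= j.+1 <= hi)%N by lia.
  by rewrite subr0 sub0r addrC.
- have -> : (lo <= j <= hi)%N by lia.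
  have -> : (lo <= j.+1 <= hi)%N = false by lia.
  by rewrite sub0r addrAC subrr.
- have -> : (lo <= j.+1 <= hi)%N = (lo <= j <= hi)%N by lia.
  by rewrite subrr addr0.
Qed.

Lemma window_le_n I x : I \in windows -> x \in window I -> (x <= n)%N.
Proof. by rewrite mem_windows mem_window; lia. Qed.

Lemma argmin_plateau_out lo hi I x : (lo <= hi)%N -> I \in windows ->
  x \in window I -> ~~ (lo <= x <= hi)%N -> argmin (plateau lo hi) I x.
Proof.
move=> lohi Iw xI xB; apply/argminP; split=> // y yI.
rewrite !psum_plateau ?(window_le_n Iw) // (negbTE xB) lerD2r.
exact: ler0n.
Qed.

Lemma argmin_plateau_const lo hi I x : (lo <= hi)%N -> I \in windows ->
  x \in window I ->
  (forall y, y \in window I -> (lo <= y <= hi)%N = (lo <= x <= hi)%N) ->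
  argmin (plateau lo hi) I x.
Proof.
move=> lohi Iw xI xB; apply/argminP; split=> // y yI.
by rewrite !psum_plateau ?(window_le_n Iw) // (xB y).
Qed.

(** The inequalities say that lowering [lo, hi] by c keeps it at least as high as
    each adjacent position, as far as a window reaching that position can see.
    So in a window not contained in the plateau, the lowest position outside it
    after the lowering is the lowest of all; in a window contained in the plateau
    all positions are lowered alike. *)
Lemma common_minimisers lo hi c w : (lo <= hi)%N ->
  (forall y, (0 < lo)%N -> (lo <= y <= hi)%N -> (y < lo + d)%N ->
    psum w lo.-1 + c <= psum w y) ->
  (forall y, (hi < n)%N -> (lo <= y <= hi)%N -> (hi < y + d)%N ->
    psum w hi.+1 + c <= psum w y) ->
  exists2 f, selects (plateau lo hi) f & selects (w - c *: plateau lo hi) f.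
Proof.
move=> lohi Hlo Hhi; set g := plateau lo hi; pose S := psum (w - c *: g).
have SE x : (x <= n)%N ->
    S x = psum w x - c * ((lo <= x <= hi)%N%:R - (lo == 0%N)%:R).
  by move=> xn; rewrite /S psumD -scaleN1r !psumZ psum_plateau // mulN1r.
have E I : exists x, I \in windows ->
    argmin g I x /\ argmin (w - c *: g) I x.
  have [Iw|] := boolP (I \in windows); last by exists 0%N.
  pose r := [seq x <- window I | ~~ (lo <= x <= hi)%N].
  have [r0|/eqP rn] := eqVneq r [::].
    have inB y : y \in window I -> (lo <= y <= hi)%N.
      move=> yI; apply/negPn/negP => yB.
      by have : y \in r by [rewrite mem_filter yB]; rewrite r0.
    have [//|x xI xmin] := @seq_argmin S (window I).
    exists x => _; split; last exact/argminP.
    by apply: argmin_plateau_const => // y yI; rewrite !inB.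
  have [|x + xmin] := @seq_argmin S r; first exact/eqP.
  rewrite mem_filter => /andP[xB xI]; exists x => _.
  split; first exact: argmin_plateau_out.
  apply/argminP; split=> // y yI.
  have [yB|yB] := boolP (lo <= y <= hi)%N; last first.
    by apply: xmin; rewrite mem_filter yB.
  (* the position next to the plateau, on the side of [x], is in the window *)
  have [z zI [zB le]] : exists2 z, z \in window I &
      ~~ (lo <= z <= hi)%N /\ psum w z + c <= psum w y.
    move: Iw xI yI; rewrite mem_windows !mem_window => Iw xI yI.
    have [xlo|xhi] : (x < lo)%N \/ (hi < x)%N by lia.
      by exists lo.-1; rewrite ?mem_window; [lia | split; [lia | apply: Hlo; lia]].
    by exists hi.+1; rewrite ?mem_window; [lia | split; [lia | apply: Hhi; lia]].
  have zr : z \in r by rewrite mem_filter zB.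
  apply: le_trans (xmin z zr) _; rewrite -/(S y) !SE ?(window_le_n Iw) //.
  by rewrite (negbTE zB) yB mulr1n mulr0n; lra.
have [f hf] := choice E.
by exists f => I /hf[].
Qed.

(** Read the entries of w from the left. Without negative entries, the last
    positive one starts a plateau reaching n. Otherwise take the first negative
    entry b: if only zeros precede it, it ends a plateau starting at 0. If not,
    the last positive entry a before it is followed by zeros up to b, so S is
    constant between a and b. When b - a < d the plateau is that interval;
    when b - a >= d, no window containing the position before the plateau sees
    the drop at b, so the plateau may extend to n. *)
Lemma exists_plateau w : w != 0 -> exists lo hi c, [/\ is_plateau (lo, hi), 0 < c,
  (forall y, (0 < lo)%N -> (lo <= y <= hi)%N -> (y < lo + d)%N ->
    psum w lo.-1 + c <= psum w y) &
  (forall y, (hi < n)%N -> (lo <= y <= hi)%N -> (hi < y + d)%N ->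
    psum w hi.+1 + c <= psum w y)].
Proof.
move=> wn0.
have after (a : 'I_n) y : (a < y)%N ->
    (forall i : 'I_n, (a < i < y)%N -> w i 0 = 0) -> psum w y = psum w a + w a 0.
  by move=> ay z; rewrite -psumS; apply/esym/psum_eq.
have before (b : 'I_n) y : (y <= b)%N ->
    (forall i : 'I_n, (y <= i < b)%N -> w i 0 = 0) ->
    psum w y = psum w b.+1 - w b 0.
  by move=> yb z; rewrite psumS addrK; apply: psum_eq.
have [/existsP[i0 neg0]|] := boolP [exists i, w i 0 < 0]; last first.
  rewrite negb_exists => /forallP pos.
  have {wn0} [i0 i0n] : exists i, w i 0 != 0.
    apply/existsP; apply: contraNT wn0 => /existsPn z.
    by apply/eqP/colP => i; rewrite mxE; apply/eqP/negPn/z.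
  case: (@arg_maxnP _ i0 (fun i => w i 0 != 0) val i0n) => a an amax.
  have ap : 0 < w a 0 by rewrite lt0r an leNgt pos.
  have z (i : 'I_n) : (a < i)%N -> w i 0 = 0.
    by move=> ai; apply/eqP; apply: contraTT ai => /amax; rewrite -leqNgt.
  have := ltn_ord a => an'.
  exists a.+1, n, (w a 0); split=> //.
  - by rewrite /is_plateau /= eqxx; lia.
  - by move=> y _ /andP[ay _] _ /=; rewrite (after a y) // => i /andP[/z].
  - by rewrite ltnn.
case: (@arg_minnP _ i0 (fun i => w i 0 < 0) val neg0) => b bneg bmin.
have nneg (i : 'I_n) : (i < b)%N -> 0 <= w i 0.
  by move=> ib; rewrite leNgt; apply: contraL ib => /bmin; rewrite -leqNgt.
have := ltn_ord b => bn.
have [/existsP[i1 pos1]|] :=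
    boolP [exists i : 'I_n, (i < b)%N && (0 < w i 0)]; last first.
  rewrite negb_exists => /forallP npos.
  have z (i : 'I_n) : (i < b)%N -> w i 0 = 0.
    move=> ib; apply/eqP; rewrite eq_le nneg // andbT leNgt.
    by have := npos i; rewrite ib.
  exists 0%N, (val b), (- w b 0); split=> //.
  - by rewrite /is_plateau /=; lia.
  - by rewrite oppr_gt0.
  - by move=> y _ /= yb _; rewrite (before b y) // => i /andP[_ /z].
case: (@arg_maxnP _ i1 (fun i : 'I_n => (i < b)%N && (0 < w i 0)) val pos1).
move=> a /andP[ab apos] amax.
have z (i : 'I_n) : (a < i < b)%N -> w i 0 = 0.
  move=> /andP[ai ib]; apply/eqP; rewrite eq_le nneg // andbT leNgt.
  apply: contraL ai => ip; rewrite -leqNgt; apply: amax.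
  by rewrite ib.
have [near|far] := ltnP (b - a) d.
  exists a.+1, (val b), (Num.min (w a 0) (- w b 0)); split=> //.
  - by rewrite /is_plateau /=; lia.
  - by rewrite lt_min apos oppr_gt0.
  - move=> y _ /= /andP[ay yb] _; rewrite (after a y) ?lerD2l ?ge_min ?lexx //.
    by move=> i ?; apply: z; lia.
  - move=> y _ /= /andP[ay yb] _; rewrite (before b y) ?lerD2l ?ge_min ?lexx ?orbT //.
    by move=> i ?; apply: z; lia.
exists a.+1, n, (w a 0); split=> //.
- by rewrite /is_plateau /= eqxx; lia.
- move=> y _ /= /andP[ay yn] yd; rewrite (after a y) // => i ?; apply: z; lia.
- by rewrite ltnn.
Qed.

Lemma plateau_neq0 lo hi : is_plateau (lo, hi) -> plateau lo hi != 0.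
Proof.
move=> /and4P[/= lohi hin pr _]; apply/eqP => e.
have S0 j : (j <= n)%N -> (lo <= j <= hi)%N%:R = (lo == 0%N)%:R :> R.
  by move=> jn; apply/eqP; rewrite -subr_eq0 -psum_plateau // e /psum big1 // => i _; rewrite mxE.
have := S0 hi hin; rewrite lohi leqnn.
case: eqP => [l0|_ /eqP]; last by rewrite oner_eq0.
have hn : (hi < n)%N by lia.
by have /eqP := S0 hi.+1 hn; rewrite ltnn andbF l0 eqxx eq_sym oner_eq0.
Qed.

(** The minimisers of the plateau in a window minimise w too, so w takes equal
    values on them. In unit windows away from the two ends this makes the entries
    of w vanish, and the window bridging an interior plateau makes the entries at
    its ends opposite; the unit windows at the ends give the sign. *)
Lemma plateau_rigid lo hi w : is_plateau (lo, hi) ->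
  (forall I x y, I \in windows -> argmin (plateau lo hi) I x ->
     y \in window I -> psum w x <= psum w y) ->
  exists2 t, 0 <= t & w = t *: plateau lo hi.
Proof.
move=> /and4P[/= lohi hin pr sh] H.
have unitw (i : 'I_n) y : (y \in window (1%N, nat_of_ord i)) = (i <= y <= i.+1)%N.
  by rewrite mem_window addn1.
have z (i : 'I_n) : i.+1 != lo -> nat_of_ord i != hi -> w i 0 = 0.
  move=> n1 n2; suff : psum w i = psum w i.+1.
    by rewrite psumS => /eqP; rewrite addrC -subr_eq subrr eq_sym => /eqP.
  have am x : x \in window (1%N, nat_of_ord i) ->
      argmin (plateau lo hi) (1%N, nat_of_ord i) x.
    move=> xI; apply: (argmin_plateau_const lohi (unit_window i) xI) => y.
    by move: xI; rewrite !unitw; lia.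
  have m1 : nat_of_ord i \in window (1%N, nat_of_ord i) by rewrite unitw; lia.
  have m2 : i.+1 \in window (1%N, nat_of_ord i) by rewrite unitw; lia.
  by apply/eqP; rewrite eq_le !(H _ _ _ (unit_window i)) // am.
have pos (i : 'I_n) : i.+1 = lo -> 0 <= w i 0.
  move=> e; rewrite -(lerD2l (psum w i)) -psumS addr0.
  apply: (H _ _ _ (unit_window i)); last by rewrite unitw; lia.
  by apply: argmin_plateau_out (unit_window i) _ _ => //; rewrite ?unitw; lia.
have neg (i : 'I_n) : nat_of_ord i = hi -> w i 0 <= 0.
  move=> e; rewrite -(lerD2l (psum w i)) -psumS addr0.
  apply: (H _ _ _ (unit_window i)); last by rewrite unitw; lia.
  by apply: argmin_plateau_out (unit_window i) _ _ => //; rewrite ?unitw; lia.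
have [lo0|lo0] := posnP lo.
  have hn : (hi < n)%N by lia.
  exists (- w (Ordinal hn) 0); first by rewrite oppr_ge0 neg.
  apply/colP => i; rewrite !mxE lo0 /=.
  have [e|ne] := eqVneq (nat_of_ord i) hi; last by rewrite z ?lo0 // subrr mulr0.
  by rewrite sub0r mulrN1 opprK; congr (w _ 0); apply: val_inj.
have an : (lo.-1 < n)%N by lia.
pose a := Ordinal an; have ea : a.+1 = lo by rewrite /=; lia.
exists (w a 0); first exact: pos.
apply/colP => i; rewrite !mxE.
have [e|ne] := eqVneq i.+1 lo.
  have -> : (nat_of_ord i == hi) = false by lia.
  by rewrite subr0 mulr1; congr (w _ 0); apply: val_inj => /=; lia.
have [e2|ne2] := eqVneq (nat_of_ord i) hi; last by rewrite z // subrr mulr0.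
have hn : (hi < n)%N by rewrite -e2.
(* the window joining the two neighbours of the plateau *)
have Iw : (hi.+1 - lo.-1, lo.-1)%N \in windows by rewrite mem_windows /=; lia.
have mI x : (x \in window (hi.+1 - lo.-1, lo.-1)%N) = (lo.-1 <= x <= hi.+1)%N.
  by rewrite mem_window /= subnKC //; lia.
have am x : (lo.-1 <= x <= hi.+1)%N -> ~~ (lo <= x <= hi)%N ->
    argmin (plateau lo hi) (hi.+1 - lo.-1, lo.-1)%N x.
  by move=> h1 h2; apply: argmin_plateau_out; rewrite ?mI.
have e : psum w a = psum w i.+1.
  rewrite e2 /=; apply/eqP; rewrite eq_le.
  by rewrite !(H _ _ _ Iw) ?mI ?am //; lia.
have e' : psum w a.+1 = psum w i.
  apply: psum_eq => [|j]; first by rewrite ea e2.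
  by rewrite ea e2 => ?; apply: z; lia.
move: e e'; rewrite !psumS => e e'; rewrite sub0r mulrN1; lra.
Qed.

Lemma pell_generatorsE :
  pell_generators R n d =
  [set plateau p.1 p.2 | p in [set p | is_plateau p]].
Proof.
apply/seteqP; split=> [g|_ [[lo hi] /= /and4P[/= lohi hin pr sh] <-]].
  case=> [[i [->|->]]|[i [j [k [hk e ->]]]]]; have := ltn_ord i => iltn.
  - exists (i.+1, n); first by rewrite /= /is_plateau /= eqxx; lia.
    apply/colP => r; rewrite !mxE eqxx andbT eqSS.
    by rewrite (ltn_eqF (ltn_ord r)) subr0.
  - exists (0%N, nat_of_ord i); first by rewrite /= /is_plateau /=; lia.
    by apply/colP => r; rewrite !mxE eqxx andbT sub0r.
  - have := ltn_ord j => jltn.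
    exists (i.+1, nat_of_ord j); first by rewrite /= /is_plateau /=; lia.
    by apply/colP => r; rewrite !mxE eqxx !andbT eqSS.
have [lo0|lo0] := posnP lo.
  have hn : (hi < n)%N by lia.
  left; exists (Ordinal hn); right.
  by apply/colP => r; rewrite !mxE lo0 eqxx andbT sub0r.
have an : (lo.-1 < n)%N by lia.
have eqa (r : 'I_n) : (r.+1 == lo) = (r == Ordinal an).
  by rewrite -val_eqE /=; lia.
have [hn|hn] := eqVneq hi n.
  left; exists (Ordinal an); left; apply/colP => r.
  by rewrite !mxE hn (ltn_eqF (ltn_ord r)) subr0 eqxx andbT eqa.
have bn : (hi < n)%N by lia.
right; exists (Ordinal an), (Ordinal bn), (hi.+1 - lo)%N; split=> /=; try lia.
by apply/colP => r; rewrite !mxE eqxx !andbT eqa.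
Qed.

(** * Rays of the fan *)

Lemma dim_ray_generated_by (g : 'cV[R]_n) :
  g != 0 -> cone_has_dim (ray_generated_by g) 1.
Proof.
move=> g0; exists <[g]>%VS; split.
- by move=> _ [t _ <-]; apply/vlineP; exists t.
- move=> U' hU; rewrite -memvE; apply: hU.
  by exists 1; rewrite ?scale1r //=.
- by rewrite dim_vline g0.
Qed.

Lemma normal_coneZ v c w : 0 <= c -> normal_cone P v w -> normal_cone P v (c *: w).
Proof. by move=> c0 nw y Py; rewrite !pairingZr ler_wpM2l // nw. Qed.

(** A one-dimensional face of a normal cone contains some [w != 0]; splitting a
    plateau off [w] inside the same cone shows that it lies on the face. *)
Lemma ray_is_plateau F : fan_rays (inner_normal_fan P) F ->
  exists2 p, is_plateau p & F = ray_generated_by (plateau p.1 p.2).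
Proof.
move=> [[v [/vertex_mem Pv [u [u0 FE]]]] [U [FU Umin dU]]].
have [w Fw wn0] : exists2 w, F w & w != 0.
  have [//|nF] := pselect (exists2 w, F w & w != 0); exfalso.
  have : (U <= 0)%VS.
    apply: Umin => w Fw; rewrite memv0; apply/negPn/negP => wn0.
    by apply: nF; exists w.
  by rewrite subv0 => /eqP U0; move: dU; rewrite U0 dimv0.
have [lo [hi [c [pl c0 H1 H2]]]] := exists_plateau wn0.
have lohi : (lo <= hi)%N by case/and4P: pl.
have [f s1 s2] := common_minimisers lohi H1 H2.
set g := plateau lo hi in s1 s2.
have [nw uw0] : normal_cone P v w /\ pairing u w = 0 by move: Fw; rewrite FE.
have sc : selects (c *: g) f.
  move=> I /s1 /argminP[fI fmin]; apply/argminP; split=> // y yI.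
  by rewrite !psumZ ler_wpM2l ?(ltW c0) // fmin.
have [ncg nr] : normal_cone P v (c *: g) /\ normal_cone P v (w - c *: g).
  by apply: normal_cone_split Pv sc s2 _; rewrite addrC subrK.
have ng : normal_cone P v g.
  rewrite -[g](scalerK (lt0r_neq0 c0)); apply: normal_coneZ ncg.
  by rewrite invr_ge0 ltW.
have ug : pairing u g = 0.
  apply/eqP; rewrite eq_le u0 // andbT -(pmulr_rle0 _ c0) -pairingZr.
  have := uw0; rewrite -[w in pairing u w](subrK (c *: g)) pairingDr.
  by have := u0 _ nr; lra.
have Fg : F g by rewrite FE.
have UE : U = <[g]>%VS.
  apply/eqP; rewrite eq_sym eqEdim -memvE FU // dU dim_vline.
  by rewrite plateau_neq0.
exists (lo, hi) => //=; rewrite -/g; apply/seteqP; split=> [x Fx|_ [t t0 <-]]; last first.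
  by rewrite FE; split; [exact: normal_coneZ | rewrite pairingZr ug mulr0].
have := FU x Fx; rewrite UE => /vlineP[t xE].
exists t => //=; rewrite leNgt; apply/negP => t0.
have /eqP := plateau_neq0 pl; apply; apply: normal_cone_pointed Pv ng _.
have -> : - plateau lo hi = (- t^-1) *: x.
  by rewrite xE scalerA mulNr mulVf ?scaleN1r // lt_eqF.
apply: normal_coneZ; first by rewrite oppr_ge0 invr_le0 ltW.
by move: Fx; rewrite FE => -[].
Qed.

Lemma psum_ones j : (j <= n)%N -> psum (const_mx 1) j = j%:R.
Proof.
elim: j => [_|j IH jn]; first exact: psum0.
by rewrite (psumS _ (Ordinal jn)) /= IH ?(ltnW jn) // mxE natr1.
Qed.

(** Large multiples of the plateau dominate the perturbation, whose prefix sums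
    break all ties. *)
Lemma vertex_on_plateau lo hi : (lo <= hi)%N ->
  exists2 f, selects (plateau lo hi) f & vertex P (lattice_point f).
Proof.
move=> lohi; pose w0 : 'cV[R]_n := n.+1%:R *: plateau lo hi + const_mx 1.
have [f sel] := selects_exists w0.
have S0 j : (j <= n)%N -> psum w0 j =
    (n.+1 * (lo <= j <= hi)%N + j)%:R - n.+1%:R * (lo == 0%N)%:R.
  move=> jn; rewrite psumD psumZ psum_plateau // psum_ones // natrD natrM.
  by rewrite mulrBr addrAC.
exists f.
  move=> I Iw; have /argminP[fI fmin] := sel I Iw; apply/argminP.
  split=> // y yI; have := fmin y yI.
  have yn := window_le_n Iw yI; have fn := window_le_n Iw fI.
  rewrite !S0 // !psum_plateau // !lerD2r !ler_nat.
  by case: (lo <= y <= hi)%N; case: (lo <= f I <= hi)%N => //=; lia.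
apply: lattice_point_vertex sel => x y; rewrite !inE => xn yn.
rewrite !S0 // => /addIr/eqP; rewrite eqr_nat => /eqP.
by case: (lo <= y <= hi)%N; case: (lo <= x <= hi)%N => //=; lia.
Qed.

(** The face is cut out by the sum of all differences between a minimiser of
    the plateau in a window and the chosen one: vanishing forces equality in
    each of them. *)
Lemma plateau_is_ray lo hi : is_plateau (lo, hi) ->
  fan_rays (inner_normal_fan P) (ray_generated_by (plateau lo hi)).
Proof.
move=> pl; split; last exact/dim_ray_generated_by/plateau_neq0.
have lohi : (lo <= hi)%N by case/and4P: pl.
have [f sel vert] := vertex_on_plateau lohi.
exists (lattice_point f); split=> //; have adm := selects_admissible sel.
pose D I x : 'rV[R]_n := prefix_step I.2 x - prefix_step I.2 (f I).
have DE I x w : I \in windows -> x \in window I ->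
    pairing (D I x) w = psum w x - psum w (f I).
  move=> Iw xI; have := adm I Iw; move: xI; rewrite !mem_window => xI fI.
  by rewrite pairingBl !pairing_prefix_step ?addrKA; [lra | lia | lia].
pose inner w I :=
  \sum_(x <- window I | argmin (plateau lo hi) I x) pairing (D I x) w.
pose u := \sum_(I <- windows)
  \sum_(x <- window I | argmin (plateau lo hi) I x) D I x.
have uE w : pairing u w = \sum_(I <- windows) inner w I.
  by rewrite pairing_suml; apply: eq_bigr => I _; rewrite pairing_suml.
have D0 w I x : normal_cone P (lattice_point f) w -> I \in windows ->
    x \in window I -> 0 <= pairing (D I x) w.
  move=> nw Iw xI; rewrite DE // subr_ge0.
  by have /argminP[_] := normal_selects adm nw Iw; apply.
have inner0 w I : normal_cone P (lattice_point f) w -> I \in windows ->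
    0 <= inner w I.
  move=> nw Iw; rewrite /inner big_seq_cond sumr_ge0 // => x /andP[xI _].
  exact: D0.
exists u; split=> [w nw|].
  by rewrite uE big_seq sumr_ge0 // => I Iw; apply: inner0.
apply/seteqP; split=> [_ [t t0 <-]|w [nw uw0]].
  have ng := lattice_point_normal sel.
  split; first exact: normal_coneZ.
  rewrite pairingZr uE big_seq big1 ?mulr0 // => I Iw.
  rewrite /inner big1 // => x /argminP[xI xmin].
  rewrite DE //; apply/eqP; rewrite subr_eq0 eq_le.
  have fI := adm I Iw; rewrite xmin //=.
  by have /argminP[_] := sel I Iw; apply.
have [|t t0 wE] := plateau_rigid (w := w) pl; last by exists t.
move=> I x y Iw xam yI; have /argminP[xI _] := xam.
have /argminP[_ /(_ y yI)] := normal_selects adm nw Iw.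
apply: le_trans; rewrite -subr_le0 -DE // le_eqVlt; apply/orP; left.
move: uw0 => /eqP; rewrite uE big_seq psumr_eq0; last by move=> J; apply: inner0.
move=> /allP/(_ I Iw)/implyP/(_ Iw).
rewrite /inner big_seq_cond psumr_eq0; last by move=> z /andP[zI _]; apply: D0.
by move=> /allP/(_ x xI)/implyP; apply; rewrite xI.
Qed.

Lemma fan_raysE :
  fan_rays (inner_normal_fan P) =
  [set ray_generated_by (plateau p.1 p.2) | p in [set p | is_plateau p]].
Proof.
apply/seteqP; split=> [F /ray_is_plateau[p pl ->]|_ [[lo hi] pl <-]].
  by exists p.
exact: plateau_is_ray.
Qed.

(** * Counting *)

Lemma plateau_sign lo hi (i : 'I_n) : (lo <= hi)%N ->
  ((0 < plateau lo hi i 0) = (i.+1 == lo)) *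
  ((plateau lo hi i 0 < 0) = (nat_of_ord i == hi)).
Proof.
move=> lohi; rewrite mxE.
have [e1|n1] := eqVneq i.+1 lo; have [e2|n2] := eqVneq (nat_of_ord i) hi.
- by lia.
- by rewrite subr0 ltr01 ltr10.
- by rewrite sub0r oppr_gt0 oppr_lt0 ltr01 ltr10.
- by rewrite subrr ltxx.
Qed.

Lemma plateau_ray_inj :
  {in [set p | is_plateau p] &,
    injective (fun p => ray_generated_by (plateau p.1 p.2))}.
Proof.
move=> [lo hi] [lo' hi'] /set_mem /= pl /set_mem /= pl' e.
have [t t0 tE] : ray_generated_by (plateau lo' hi') (plateau lo hi).
  by rewrite -e; exists 1; rewrite ?scale1r //=.
have pos : 0 < t.
  rewrite lt0r t0 andbT; apply/eqP => t00.
  by have := plateau_neq0 pl; rewrite -tE t00 scale0r eqxx.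
case/and4P: pl pl' => /= lohi hin _ _ /and4P[/= lohi' hin' _ _].
have ends (i : 'I_n) : ((i.+1 == lo) = (i.+1 == lo')) *
    ((nat_of_ord i == hi) = (nat_of_ord i == hi')).
  rewrite -!(plateau_sign i lohi) -!(plateau_sign i lohi') -tE mxE.
  by rewrite pmulr_rgt0 // pmulr_rlt0.
congr pair.
  have [a|a] := posnP lo; have [a'|a'] := posnP lo'; first by rewrite a.
  - have an : (lo'.-1 < n)%N by lia.
    by have := (ends (Ordinal an)).1; rewrite /=; lia.
  - have an : (lo.-1 < n)%N by lia.
    by have := (ends (Ordinal an)).1; rewrite /=; lia.
  - have an : (lo.-1 < n)%N by lia.
    by have := (ends (Ordinal an)).1; rewrite /=; lia.
have [a|a] := ltnP hi n.
  by have := (ends (Ordinal a)).2; rewrite /= eqxx => /esym/eqP.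
have [a'|a'] := ltnP hi' n; last by lia.
by have := (ends (Ordinal a')).2; rewrite /= eqxx => /eqP.
Qed.

(** After the n plateaus starting at 0, row k >= 1 lists the n - k interior
    plateaus of length k, and row 0 the n plateaus [lo, n] with lo >= 1; the rows
    then have sizes n, n - 1, ..., n - d + 1. *)
Definition plateau_list : seq (nat * nat) :=
  [seq (0%N, hi) | hi <- iota 0 n] ++
  [seq (lo, if k == 0%N then n else (lo + k).-1) |
     k <- iota 0 d, lo <- iota 1 (n - k)].

Lemma mem_plateau_list p : (p \in plateau_list) = is_plateau p.
Proof.
case: p => lo hi; rewrite mem_cat; apply/idP/idP.
  case/orP=> [/mapP[x]|/allpairsPdep[k [l []]]]; rewrite !mem_iota.
    by move=> hx [-> ->]; rewrite /is_plateau /=; lia.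
  move=> hk hl [-> ->]; rewrite /is_plateau /=.
  case: eqP => k0; lia.
move=> /and4P[/= lohi hin pr sh]; apply/orP.
have [lo0|lo0] := posnP lo.
  by left; rewrite lo0; apply: map_f; rewrite mem_iota; lia.
right; apply/allpairsPdep; have [hn|hn] := eqVneq hi n.
  by exists 0%N, lo; rewrite !mem_iota hn; split=> //; lia.
exists (hi.+1 - lo)%N, lo; rewrite !mem_iota; split; try lia.
by case: eqP => ?; congr pair; lia.
Qed.

Lemma plateau_list_uniq : uniq plateau_list.
Proof.
rewrite cat_uniq map_inj_uniq ?iota_uniq => [|x y [] //] /=.
apply/andP; split.
  apply/hasPn => _ /allpairsPdep[k [l [_ + ->]]].
  by rewrite mem_iota => h; apply/negP => /mapP[x _ []]; lia.
apply: allpairs_uniq_dep => [|k _|]; try exact: iota_uniq.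
move=> _ _ /allpairsPdep[k [l [+ + ->]]] /allpairsPdep[k' [l' [+ + ->]]] /=.
rewrite !mem_iota => h1 h2 h3 h4 [el e].
suff ek : k = k' by rewrite ek el.
by move: e; case: (k =P 0%N) => ?; case: (k' =P 0%N) => ?; lia.
Qed.

Lemma sum_top_naturals m : (m <= n)%N ->
  (\sum_(0 <= k < m) (n - k) = \sum_(n - m + 1 <= j < n.+1) j)%N.
Proof.
elim: m => [_|m IH mn]; first by rewrite subn0 addn1 !big_geq.
rewrite big_nat_recr //= IH ?(ltnW mn) // [RHS]big_ltn; last by lia.
rewrite addnC; have -> : (n - m.+1 + 1 = n - m)%N by lia.
by rewrite addn1.
Qed.

Lemma size_plateau_list :
  size plateau_list = (n + \sum_(n - d + 1 <= j < n.+1) j)%N.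
Proof.
rewrite size_cat size_map size_iota size_allpairs_dep; congr addn.
rewrite -sum_top_naturals // sumnE big_map /index_iota subn0.
by apply: eq_bigr => k _; rewrite size_iota.
Qed.

Lemma card_plateaus :
  ([set p | is_plateau p] #= `I_(n + \sum_(n - d + 1 <= j < n.+1) j)%N)%card.
Proof.
have -> : [set p | is_plateau p] = [set` [fset p in plateau_list]%fset].
  by apply/seteqP; split=> p /=; rewrite in_fset -mem_plateau_list.
apply/card_eq_fsetP; rewrite card_fseq undup_id ?plateau_list_uniq //.
exact: size_plateau_list.
Qed.

End CatalanPellytope.

Theorem corollary3p19 (R : realType) (d n : nat) (hd : (1 <= d)%N) (hdn : (d <= n)%N) :
  (fan_rays (inner_normal_fan (catalan_pellytope R d n))
     #= `I_(n + \sum_(n - d + 1 <= j < n.+1) j)%N)%card /\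
  fan_rays (inner_normal_fan (catalan_pellytope R d n)) =
    [set ray_generated_by g | g in pell_generators R n d].
Proof.
rewrite fan_raysE // pell_generatorsE //; split; last first.
  by rewrite image_comp.
apply: card_eq_trans (card_plateaus hd hdn).
exact/inj_card_eq/plateau_ray_inj.
Qed.
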